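(* Let $m \ge 1$ be an integer and $a$ an indeterminate. For every nonnegative integer $n$, $$\sum_{\lambda \in A_m(n)} \omega_1(\lambda) = \sum_{\mu \in B_m(n)} \omega_2(\mu),$$ where for $\lambda = (\lambda_1, \ldots, \lambda_l) \in A_m(n)$ we set $\omega_1(\lambda) = (-1)^{l-1} a^{\ell_o(\lambda)}$, and for $\mu = (\mu_1, \ldots, \mu_l) \in B_m(n)$ we set $\omega_2(\mu) = (-a)^l$.
   Context: $A_m(n)$ is the set of nonempty strictly decreasing finite sequences $\lambda = (\lambda_1 > \cdots > \lambda_l)$ of nonnegative integers (so $0$ may occur as a part, at most once) with sum $n$, such that every even part is a multiple of $2m$ (this includes the part $0$) and the smallest part $\lambda_l$ is even. $B_m(n)$ is the set of partitions $\mu = (\mu_1 > \mu_2 > \cdots > \mu_l)$ of $n$ into $l \ge 0$ distinct odd positive parts such that $\mu_i - \mu_{i+1} \le 2m$ for all $1 \le i \le l$, with the convention $\mu_{l+1} = 0$ (the empty partition belongs to $B_m(0)$). In both cases $l$ is the number of parts (a part $0$ counts as a part), and $\ell_o(\lambda)$ is the number of odd parts of $\lambda$. *)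

(* Defs.v *)
From HB Require Import structures.
From mathcomp Require Import all_boot all_order all_algebra finmap.

Set Implicit Arguments.
Unset Strict Implicit.
Unset Printing Implicit Defensive.

Import GRing.Theory.

Local Open Scope nat_scope.

(* Sequences list the parts in decreasing order: lambda_i is [nth 0 s i.-1]. *)

Definition inA (m n : nat) (s : seq nat) : bool :=
  [&& s != [::], sorted gtn s, sumn s == n,
      all (fun p => ~~ odd p ==> (2 * m %| p)) s
    & ~~ odd (last 0 s)].

(* The default value 0 of [nth] implements the convention mu_(l+1) = 0. *)
Definition inB (m n : nat) (s : seq nat) : bool :=
  [&& sorted gtn s, sumn s == n, all odd s
    & [forall i : 'I_(size s), nth 0 s i - nth 0 s i.+1 <= 2 * m]].

(* All strictly decreasing sequences with parts in {0, ..., n}, a finite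
   superset of the sequences of sum n; see [mem_decseqs]. *)
Definition decseqs (n : nat) : seq (seq nat) :=
  [seq mask b (rev (iota 0 n.+1)) | b : n.+1.-tuple bool].

Definition A (m n : nat) : {fset seq nat} :=
  [fset s in decseqs n | inA m n s]%fset.

Definition B (m n : nat) : {fset seq nat} :=
  [fset s in decseqs n | inB m n s]%fset.

Definition odd_parts (s : seq nat) : nat := count odd s.

Local Open Scope ring_scope.

Definition omega1 (s : seq nat) : {poly int} :=
  (-1) ^+ (size s).-1 * 'X ^+ odd_parts s.

Definition omega2 (s : seq nat) : {poly int} := (- 'X) ^+ size s.

Local Close Scope ring_scope.

Lemma mem_decseqs n s : sorted gtn s -> sumn s = n -> s \in decseqs n.
Proof.
move=> ss sn.
have le_n p : p \in s -> p < n.+1.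
  rewrite ltnS -sn; elim: (s) => //= x t IH; rewrite inE.
  case/orP=> [/eqP->|/IH h]; first exact: leq_addr.
  exact: leq_trans h (leq_addl _ _).
have sr : sorted gtn (rev (iota 0 n.+1)) by rewrite rev_sorted iota_ltn_sorted.
have gtn_trans : transitive gtn by move=> y x z /= yx zy; apply: ltn_trans yx.
have /subseqP[b sb ->] : subseq s (rev (iota 0 n.+1)).
  have -> : s = [seq p <- rev (iota 0 n.+1) | p \in s].
    apply: (irr_sorted_eq gtn_trans) => //; first exact: ltnn.
      exact: sorted_filter.
    move=> p; rewrite mem_filter mem_rev mem_iota /= add0n.
    by case: (boolP (p \in s)) => // /le_n ->.
  exact: filter_subseq.
have sb' : size b == n.+1 by rewrite sb size_rev size_iota.
by apply/mapP; exists (Tuple sb'); rewrite ?mem_enum.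
Qed.

Lemma mem_A m n s : (s \in A m n) = inA m n s.
Proof.
rewrite !inE /=; apply/andP/idP=> [[]//|h]; split=> //.
by case/and5P: h => _ ss /eqP sn _ _; apply: mem_decseqs.
Qed.

Lemma mem_B m n s : (s \in B m n) = inB m n s.
Proof.
rewrite !inE /=; apply/andP/idP=> [[]//|h]; split=> //.
by case/and4P: h => ss /eqP sn _ _; apply: mem_decseqs.
Qed.

(* Main.v *)
Require Import Defs.
From HB Require Import structures.
From mathcomp Require Import all_boot all_order all_algebra finmap.
From mathcomp Require Import zify ring.

(** Put [x = q^(2m)]. Summing over the smallest part [2mk], the generating
    function of [A_m] is the case [s = 0] of
      [F_s = sum_k x^k prod_(j > k) (1 - x^j)
               prod_(p odd, p > 2mk + 2s) (1 - a q^p)].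
    Splitting off the first odd factor, and using
    [sum_k x^(2k) ... = F_s - x F_(s+m)], one gets
      [F_s - F_(s+1) = - a q^(2s+1) (F_(s+1) - x F_(s+1+m))],
    which telescopes to
      [F_s = 1 - a sum_(0 <= j < m) q^(2(s+j)+1) F_(s+j+1)].
    This is also the recursion that builds the partitions of [B_m] by choosing
    the smallest part [2(s+j)+1], so [F_0] is the generating function of [B_m].
    Convergence is replaced by nilpotency: [q] is the class of the variable
    modulo [q^(n+1)]. *)

Set Implicit Arguments.
Unset Strict Implicit.
Unset Printing Implicit Defensive.

Import GRing.Theory.

Local Open Scope ring_scope.

(** * The recursion for [F_s] in a ring where [q ^+ N = 0] *)

Section NilpotentIdentity.

Variables (R : comNzRingType) (a q : R) (N m : nat).
Hypotheses (qN : q ^+ N = 0) (m_gt0 : (0 < m)%N).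

Let x := q ^+ (2 * m).

Definition oddprod (t : nat) : R := \prod_(t <= p < N | odd p) (1 - a * q ^+ p).

Definition evenprod (k : nat) : R :=
  \prod_((2 * m * k).+1 <= p < N | (2 * m %| p)%N) (1 - q ^+ p).

(** This is [F_s]: terms with [k > N] vanish by [xN], and factors with [p >= N] of the infinite
    products equal 1. *)
Definition smallest_even_gf (s : nat) : R :=
  \sum_(0 <= k < N.+1) x ^+ k * evenprod k * oddprod (2 * (m * k + s)).

Lemma expr_ge_nil (p : nat) : (N <= p)%N -> q ^+ p = 0.
Proof. by move=> /subnK <-; rewrite exprD qN mulr0. Qed.

Lemma xE (k : nat) : x ^+ k = q ^+ (2 * m * k).
Proof. by rewrite -exprM. Qed.

Lemma xN (k : nat) : (N <= k)%N -> x ^+ k = 0.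
Proof. by move=> Nk; rewrite xE expr_ge_nil //; nia. Qed.

Lemma oddprod_rec (s : nat) :
  oddprod (2 * s) = (1 - a * q ^+ (2 * s).+1) * oddprod (2 * s.+1).
Proof.
rewrite /oddprod.
have [lt|ge] := ltnP (2 * s).+1 N.
  rewrite big_ltn_cond ?(ltnW lt) // ifF; last lia.
  rewrite big_ltn_cond // ifT; last lia.
  by have -> : (2 * s.+1 = (2 * s).+2)%N by lia.
rewrite expr_ge_nil // mulr0 subr0 mul1r [RHS]big_geq; last lia.
rewrite big_nat_cond big_pred0 // => i.
lia.
Qed.

Lemma evenprod_rec (k : nat) : evenprod k = (1 - x ^+ k.+1) * evenprod k.+1.
Proof.
rewrite /evenprod xE.
have E p : (2 * m * k < p < 2 * m * k.+1)%N -> (2 * m %| p)%N = false.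
  move=> /andP[h1 h2]; apply/negP => /dvdnP[c]; rewrite mulnC => Ep.
  by move: h1 h2; rewrite Ep !ltn_pmul2l ?muln_gt0 //; lia.
have [lt|ge] := ltnP (2 * m * k.+1) N.
  rewrite (@big_cat_nat _ _ _ (2 * m * k.+1)) //=; [|nia|lia].
  rewrite big_nat_cond big_pred0 ?mul1r; last first.
    by move=> i; case: (boolP (_ < i < _)%N) => // /E ->.
  by rewrite big_ltn_cond // dvdn_mulr.
rewrite expr_ge_nil // subr0 mul1r [RHS]big_geq; last lia.
rewrite big_nat_cond big_pred0 // => i.
case: (boolP (_ < i < _)%N) => //= h; apply: E; lia.
Qed.

(** All odd products are empty. By [evenprod_rec], the sum of [x^k * evenprod k] up to [K]
    telescopes to [evenprod K], which is empty at [K = N]. *)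
Lemma smallest_even_gf_large (s : nat) : (N <= s)%N -> smallest_even_gf s = 1.
Proof.
move=> Ns; rewrite /smallest_even_gf.
under eq_bigr => k _.
  have -> : oddprod (2 * (m * k + s)) = 1 by rewrite /oddprod big_geq //; nia.
  rewrite mulr1; over.
have -> : \sum_(0 <= k < N.+1) x ^+ k * evenprod k = evenprod N.
  elim: (N) => [|K IH]; first by rewrite big_nat1 mul1r.
  by rewrite big_nat_recr //= IH evenprod_rec; ring.
by rewrite /evenprod big_geq //; nia.
Qed.

(** Replacing [s] by [s + m] has the effect of [k -> k + 1] on the odd product, so [evenprod_rec]
    turns [x * F_(s+m)] into the sum of [x^k (1 - x^k) ...], whose term at [k = 0] is zero. *)
Lemma smallest_even_gf_square (s : nat) :
  smallest_even_gf s - x * smallest_even_gf (s + m) =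
  \sum_(0 <= k < N.+1) x ^+ k * x ^+ k * evenprod k * oddprod (2 * (m * k + s)).
Proof.
(* [T K] is the boundary term of the reindexed partial sum; at [K = N] its factor [x^(N+1)]
   vanishes. *)
pose T k := x ^+ k.+1 * evenprod k * oddprod (2 * (m * k.+1 + s)).
suff H K : \sum_(0 <= k < K.+1) x ^+ k * evenprod k * oddprod (2 * (m * k + s))
     - x * \sum_(0 <= k < K.+1)
           x ^+ k * evenprod k * oddprod (2 * (m * k + (s + m))) =
   \sum_(0 <= k < K.+1) x ^+ k * x ^+ k * evenprod k * oddprod (2 * (m * k + s))
   - T K.
  by rewrite /smallest_even_gf H /T xN // !mul0r subr0.
have shift k : (m * k + (s + m) = m * k.+1 + s)%N by lia.
elim: K => [|K IH]; first by rewrite !big_nat1 /T shift; ring.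
rewrite !(@big_nat_recr _ _ _ K.+1) //= mulrDr opprD addrACA IH /T !shift.
rewrite (evenprod_rec K) !exprS; ring.
Qed.

(** Termwise, splitting off the first odd factor leaves [- a q^(2mk + 2s + 1)]; its part
    [q^(2mk) = x^k] supplies the second [x^k]. *)
Lemma smallest_even_gf_diff (s : nat) :
  smallest_even_gf s - smallest_even_gf s.+1 =
  - a * q ^+ (2 * s).+1 * (smallest_even_gf s.+1 - x * smallest_even_gf (s.+1 + m)).
Proof.
rewrite smallest_even_gf_square /smallest_even_gf -sumrB mulr_sumr.
apply: eq_bigr => k _; rewrite oddprod_rec addnS.
have -> : ((2 * (m * k + s)).+1 = 2 * m * k + (2 * s).+1)%N by lia.
by rewrite exprD -xE; ring.
Qed.

(* By [smallest_even_gf_diff] the difference [D] of [F_s] and the sum over [j]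
   does not depend on [s], and [D = 1] for large [s]. *)
Lemma smallest_even_gf_rec (s : nat) :
  smallest_even_gf s =
  1 + \sum_(0 <= j < m) - a * q ^+ (2 * (s + j)).+1 * smallest_even_gf (s + j).+1.
Proof.
pose C t := - a * q ^+ (2 * t).+1 * smallest_even_gf t.+1.
pose D t := smallest_even_gf t - \sum_(0 <= j < m) C (t + j)%N.
have DS t : D t = D t.+1.
  apply/eqP; rewrite /D -subr_eq0; apply/eqP.
  have tel : \sum_(0 <= j < m) C (t + j)%N - \sum_(0 <= j < m) C (t.+1 + j)%N
       = C t - C (t + m)%N.
    transitivity (- \sum_(0 <= j < m) (C (t + j.+1)%N - C (t + j)%N)).
      by rewrite -sumrB -sumrN; apply: eq_bigr => j _; rewrite opprB addSnnS.
    by rewrite (telescope_sumr (fun j => C (t + j)%N)) // addn0 opprB.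
  have := smallest_even_gf_diff t; move: tel.
  rewrite {3 4}/C /x; set A := \sum_(0 <= j < m) _; set B := \sum_(0 <= j < m) _.
  move=> tel dif.
  have -> : smallest_even_gf t - A - (smallest_even_gf t.+1 - B) =
     (smallest_even_gf t - smallest_even_gf t.+1) - (A - B) by ring.
  rewrite tel dif addSn.
  have -> : ((2 * (t + m)).+1 = (2 * t).+1 + 2 * m)%N by lia.
  by rewrite exprD; ring.
have D1 : D s = 1.
  have -> : D s = D (s + N)%N.
    by elim: (N) => [|k IH]; rewrite ?addn0 // addnS -DS.
  rewrite /D smallest_even_gf_large ?leq_addl // big1 ?subr0 // => j _.
  by rewrite /C expr_ge_nil ?mulr0 ?mul0r //; lia.
by rewrite -[LHS](subrK (\sum_(0 <= j < m) C (s + j)%N)) -/(D s) D1.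
Qed.

End NilpotentIdentity.

(** * Expanding a product over subsequences *)

Section Subseqs.

Variable T : eqType.
Implicit Types (r t : seq T).

Fixpoint subseqs r : seq (seq T) :=
  if r is y :: r' then subseqs r' ++ [seq y :: t | t <- subseqs r'] else [:: [::]].

Lemma mem_subseqs r t : (t \in subseqs r) = subseq t r.
Proof.
elim: r t => [|y r IH] [|z t] //=; rewrite mem_cat IH ?sub0seq //.
case: eqP => [->|zy].
  rewrite mem_map ?IH; last by move=> ? ? [].
  by apply/orP/idP => [[/cons_subseq|]|->] //; right.
by case: mapP => [[t' _ [/zy]]|]; rewrite ?orbF.
Qed.

Lemma subseqs_uniq r : uniq r -> uniq (subseqs r).
Proof.
elim: r => //= y r IH /andP[yr /IH Ur]; rewrite cat_uniq Ur /= map_inj_uniq ?Ur.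
  rewrite andbT; apply/hasPn => _ /mapP[t _ ->]; apply: contra yr.
  by rewrite mem_subseqs => /mem_subseq; apply; rewrite mem_head.
by move=> ? ? [].
Qed.

Lemma sum_subseqs (R : comNzRingType) (f : T -> R) r :
  \sum_(t <- subseqs r) \prod_(p <- t) f p = \prod_(p <- r) (1 + f p).
Proof.
elim: r => [|y r IH] /=; first by rewrite big_seq1 !big_nil.
rewrite big_cat /= big_map IH big_cons mulrDl mul1r; congr (_ + _).
by under eq_bigr => t _ do rewrite big_cons; rewrite -mulr_sumr IH.
Qed.

End Subseqs.

(** * Recursive enumerations of [A_m(n)] and [B_m(n)] *)

Section Enumerations.

Variable m : nat.
Hypothesis m_gt0 : (0 < m)%N.

Definition partsA (k N : nat) : seq nat :=
  [seq p <- index_iota (2 * m * k).+1 N | odd p || (2 * m %| p)%N].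

Definition listA (N : nat) : seq (seq nat) :=
  [seq rcons t (2 * m * k)%N | k <- iota 0 N.+1, t <- subseqs (rev (partsA k N))].

(* Parts in increasing order, at most [f] of them, the smallest one being
   [2(s+j)+1] with [j < m]. *)
Fixpoint revlistB (f s : nat) : seq (seq nat) :=
  if f is f'.+1 then
    [::] :: [seq (2 * (s + j)).+1 :: t | j <- iota 0 m, t <- revlistB f' (s + j).+1]
  else [:: [::]].

Lemma listA_uniq (N : nat) : uniq (listA N).
Proof.
apply: (@allpairs_uniq_dep nat (fun=> seq nat)) => [|k _|]; first exact: iota_uniq.
  by rewrite subseqs_uniq // rev_uniq filter_uniq // iota_uniq.
move=> [k t] [k' t'] _ _ /= /rcons_inj[-> /eqP].
by rewrite eqn_pmul2l ?muln_gt0 // => /eqP->.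
Qed.

Lemma gtn_trans : transitive gtn.
Proof. by move=> y x z /= yx zy; apply: ltn_trans yx. Qed.

Lemma leq_sumn (p : nat) (s : seq nat) : p \in s -> (p <= sumn s)%N.
Proof. by elim: s => //= y s IH; rewrite inE => /orP[/eqP->|/IH]; lia. Qed.

(** Every part is at most the sum [n], so the bound [n.+1] on the parts cuts nothing off. *)
Lemma mem_listA (n : nat) (s : seq nat) :
  (s \in listA n.+1) && (sumn s == n) = inA m n s.
Proof.
rewrite /inA andbC [sorted _ _ && _]andbCA andbCA; case: eqP => //= sn.
case/lastP: s sn => [|t y] sn.
  by apply/negbTE/allpairsPdep => -[k [t [_ _]]]; case: t.
rewrite last_rcons all_rcons (sorted_pairwise gtn_trans) pairwise_rcons.
rewrite -(sorted_pairwise gtn_trans).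
have lt_n p : p \in rcons t y -> (p < n.+1)%N by move/leq_sumn; rewrite sn ltnS.
have -> : rcons t y != [::] by case: (t).
have sorted_parts k : sorted gtn (rev (partsA k n.+1)).
  by rewrite rev_sorted; apply: sorted_filter ltn_trans _ _ (iota_ltn_sorted _ _).
apply/allpairsPdep/idP => [[k [t' [_]]]|/and4P[_ /andP[ty st] /andP[my mt] ey]].
  rewrite mem_subseqs => st /rcons_inj[-> ->].
  rewrite (subseq_sorted gtn_trans st) // dvdn_mulr // implybT andbT /=.
  apply/and3P; split; last lia; apply/allP => p /(mem_subseq st);
    rewrite mem_rev mem_filter mem_index_iota => /andP[okp /andP[kp _]] //.
  by move: okp; case: (odd p).
have /dvdnP[k yE] : (2 * m %| y)%N by rewrite ey in my.
rewrite mulnC in yE; exists k, t; rewrite -yE; split=> //.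
  by rewrite mem_iota; have := lt_n y; rewrite mem_rcons mem_head yE; nia.
rewrite mem_subseqs.
(* Two strictly decreasing sequences with the same elements coincide. *)
suff -> : t = [seq p <- rev (partsA k n.+1) | p \in t] by exact: filter_subseq.
apply: (irr_sorted_eq gtn_trans) => //; first exact: ltnn.
  exact: sorted_filter gtn_trans _ _ (sorted_parts k).
move=> p; rewrite mem_filter mem_rev mem_filter mem_index_iota -yE.
case: (boolP (p \in t)) => //= pt.
have /= -> := allP ty _ pt; rewrite lt_n ?mem_rcons ?inE ?pt ?orbT // andbT.
by have := allP mt _ pt; case: (odd p) => //= ->.
Qed.

Lemma revlistB_uniq (f s : nat) : uniq (revlistB f s).
Proof.
elim: f s => //= f IH s; apply/andP; split.
  by apply/allpairsPdep => -[j [t []]].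
apply: (@allpairs_uniq_dep nat (fun=> seq nat)) => [|j _|]; rewrite ?iota_uniq //.
by move=> [j t] [j' t'] _ _ /= [E ->]; have -> : j = j' by lia.
Qed.

(** Relation between neighbouring parts read in increasing order; a path started at 0 encodes the
    convention [mu_(l+1) = 0]. *)
Definition stepB (x y : nat) : bool := [&& (x < y)%N, odd y & (y - x <= 2 * m)%N].

(** For [s > 0] the path starts at the preceding part [2s - 1]; for [s = 0] truncated subtraction
    gives 0. In both cases the gap up to [2(s+j)+1] is at most [2m] exactly when [j < m]. *)
Lemma mem_revlistB (f s : nat) (t : seq nat) :
  (t \in revlistB f s) = path stepB (2 * s).-1 t && (size t <= f)%N.
Proof.
elim: f s t => [|f IH] s [|y t] //=; first by rewrite andbF.
rewrite inE /= ltnS; apply/allpairsPdep/idP => [[j [t' []]]|].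
  rewrite mem_iota IH => jm /andP[pt st] [-> ->].
  rewrite st andbT; apply/andP; split; first by rewrite /stepB; lia.
  by have -> : (2 * (s + j)).+1 = (2 * (s + j).+1).-1 by lia.
rewrite /stepB => /andP[/andP[/and3P[h1 h2 h3] pt] st].
exists (y./2 - s)%N, t; rewrite mem_iota IH.
have -> : (s + (y./2 - s) = y./2)%N by lia.
have E : (2 * y./2).+1 = y by lia.
have -> : ((2 * y./2.+1).-1 = y)%N by lia.
by rewrite E pt st; split=> //; lia.
Qed.

Lemma inB_path (n : nat) (s : seq nat) :
  inB m n s = path stepB 0 (rev s) && (sumn s == n).
Proof.
rewrite /inB andbCA [RHS]andbC; congr (_ && _).
elim: s => [|y s IH]; first by apply/forallP => -[].
rewrite rev_cons rcons_path -{}IH.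
have -> : [forall i : 'I_(size (y :: s)),
      nth 0 (y :: s) i - nth 0 (y :: s) i.+1 <= 2 * m]%N =
    (y - nth 0 s 0 <= 2 * m)%N &&
    [forall i : 'I_(size s), nth 0 s i - nth 0 s i.+1 <= 2 * m]%N.
  apply/forallP/andP => [H|[H0 /forallP H] i].
    by split; [exact: (H ord0) | apply/forallP => i; exact: (H (lift ord0 i))].
  by case: (unliftP ord0 i) => [j ->|->]; [exact: (H j) | exact: H0].
rewrite /stepB; case: s => [|z s] /=.
  by case: [forall i, _]; case: y => [|y]; rewrite ?andbT ?andbF.
rewrite rev_cons last_rcons.
by case: (z < y)%N; case: (odd y); case: (y - z <= 2 * m)%N; rewrite /= ?andbT ?andbF.
Qed.

Lemma path_stepB_odd (x : nat) (t : seq nat) : path stepB x t -> all odd t.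
Proof. by elim: t x => //= y t IH x /andP[/and3P[_ -> _] /IH]. Qed.

Lemma size_path_stepB (x : nat) (t : seq nat) :
  path stepB x t -> (size t <= sumn t)%N.
Proof.
by elim: t x => //= y t IH x /andP[/and3P[xy _ _] /IH]; lia.
Qed.

(** Positive parts with sum [n] number at most [n], so the length bound [n.+1] holds
    automatically. *)
Lemma mem_revlistB0 (n : nat) (s : seq nat) :
  (rev s \in revlistB n.+1 0) && (sumn s == n) = inB m n s.
Proof.
rewrite mem_revlistB inB_path muln0 /= -andbA; case pt: (path _ _ _) => //=.
have := size_path_stepB pt; rewrite size_rev sumn_rev.
by move=> h; rewrite andb_idl // => /eqP <-; apply: leqW.
Qed.

(** * Both enumerations have generating function [F_0] *)

Section GeneratingFunctions.

Variables (R : comNzRingType) (a q : R).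

Definition signed_weight (p : nat) : R := - ((if odd p then a else 1) * q ^+ p).

Lemma prod_signed_weight (t : seq nat) :
  \prod_(p <- t) signed_weight p =
  (-1) ^+ size t * a ^+ odd_parts t * q ^+ sumn t.
Proof.
rewrite /odd_parts; elim: t => [|p t IH]; first by rewrite big_nil !mulr1.
rewrite big_cons IH /= exprS !exprD /signed_weight.
by case: (odd p); rewrite ?expr1 ?expr0; ring.
Qed.

Lemma prod_partsA (N k : nat) :
  \prod_(p <- rev (partsA k N)) (1 + signed_weight p) =
  evenprod q N m k * oddprod a q N (2 * (m * k)).
Proof.
rewrite (perm_big (partsA k N)) ?perm_rev // big_filter (bigID odd) /= mulrC.
congr (_ * _).
  apply: eq_big => [p|p /andP[_ /negbTE po]]; last by rewrite /signed_weight po mul1r.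
  case: (boolP (odd p)) => [po|]; rewrite ?andbT //=; apply/esym/negbTE/negP.
  by case/dvdnP=> c E; move: po; rewrite E; lia.
(* The lower bound [2mk] is even and contributes no odd factor. *)
have -> : oddprod a q N (2 * (m * k)) = oddprod a q N (2 * m * k).+1.
  rewrite mulnA /oddprod; have [lt|ge] := ltnP (2 * m * k) N.
    by rewrite big_ltn_cond // ifF //; lia.
  by rewrite !big_geq // leqW.
apply: eq_big => [p|p /andP[_ po]]; last by rewrite /signed_weight po.
by case: (odd p); rewrite ?andbF.
Qed.

(** The smallest part [2mk] gives [x^k] without a sign, whence the exponent [l - 1]; the other parts
    expand the two products. *)
Lemma sum_listA (N : nat) :
  \sum_(s <- listA N) (-1) ^+ (size s).-1 * a ^+ odd_parts s * q ^+ sumn s =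
  smallest_even_gf a q N m 0.
Proof.
rewrite big_allpairs_dep /smallest_even_gf /index_iota subn0.
apply: eq_bigr => k _; rewrite addn0 -mulrA -prod_partsA -sum_subseqs mulr_sumr.
apply: eq_bigr => t _; rewrite prod_signed_weight xE size_rcons /odd_parts.
rewrite -cats1 count_cat sumn_cat /= !addn0 exprD.
have -> : odd (2 * m * k) = false by lia.
by rewrite exprD expr0; ring.
Qed.

(** Choosing the smallest part is the recursion [smallest_even_gf_rec]; when [f = 0], [s >= N] and
    both sides are 1. *)
Lemma sum_revlistB (N f s : nat) : q ^+ N = 0 -> (N <= f + s)%N ->
  \sum_(t <- revlistB f s) \prod_(p <- t) signed_weight p =
  smallest_even_gf a q N m s.
Proof.
move=> qN; elim: f s => [|f IH] s Ns.
  by rewrite big_seq1 big_nil smallest_even_gf_large.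
rewrite smallest_even_gf_rec //= big_cons big_nil; congr (_ + _).
rewrite big_allpairs_dep /index_iota subn0; apply: eq_bigr => j _.
rewrite -IH; last lia.
rewrite mulr_sumr; apply: eq_bigr => t _; rewrite big_cons /signed_weight.
have -> : odd (2 * (s + j)).+1 by lia.
by rewrite !mulNr.
Qed.

End GeneratingFunctions.

End Enumerations.

(** * Passage to the quotient and extraction of the coefficient *)

Lemma coef_gf (S : nzRingType) (r : seq (seq nat)) (w : seq nat -> S) (n : nat) :
  (\sum_(s <- r) (w s)%:P * 'X^(sumn s))`_n = \sum_(s <- r | sumn s == n) w s.
Proof.
rewrite coef_sum [RHS]big_mkcond; apply: eq_bigr => s _.
by rewrite coefCM coefXn eq_sym; case: eqP; rewrite ?mulr1 ?mulr0.
Qed.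

Lemma in_qpoly_Xn_coef (S : comNzRingType) (n : nat) (p r : {poly S}) :
  in_qpoly 'X^(n.+1) p = in_qpoly 'X^(n.+1) r -> p`_n = r`_n.
Proof.
move/(congr1 val) => /=; rewrite mk_monic_Xn /= => E.
rewrite (Pdiv.RingMonic.rdivp_eq (monicXn S n.+1) p).
rewrite (Pdiv.RingMonic.rdivp_eq (monicXn S n.+1) r) E.
by rewrite !coefD !coefMXn ltnSn.
Qed.

(** The inner variable plays [a], the outer one [q]. On the [B] side all parts are odd, so [omega2]
    is a product of signed weights. *)
Lemma gf_morph (T : comNzRingType) (phi : {rmorphism {poly {poly int}} -> T})
    (m N : nat) :
  (0 < m)%N -> phi 'X^N = 0 ->
  phi (\sum_(s <- listA m N) (omega1 s)%:P * 'X^(sumn s)) =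
  phi (\sum_(t <- revlistB m N 0) (omega2 t)%:P * 'X^(sumn t)).
Proof.
move=> m_gt0; rewrite rmorphXn => qN.
have w (i j k : nat) :
    phi (((-1) ^+ i * 'X ^+ j)%:P * 'X^k) = (-1) ^+ i * phi 'X%:P ^+ j * phi 'X ^+ k.
  by rewrite !rmorphM !rmorphXn !rmorphN1.
rewrite !rmorph_sum; transitivity (smallest_even_gf (phi 'X%:P) (phi 'X) N m 0).
  by rewrite -(sum_listA m_gt0); apply: eq_bigr => s _; rewrite w.
rewrite -(@sum_revlistB m m_gt0 _ _ _ N N) ?addn0 // [LHS]big_seq [RHS]big_seq.
apply: eq_bigr => t; rewrite mem_revlistB // => /andP[/path_stepB_odd].
rewrite all_count => /eqP oddt _.
by rewrite prod_signed_weight /omega2 /odd_parts oddt -w -exprNn.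
Qed.

Theorem theorem8p2 (m : nat) (hm : (1 <= m)%N) (n : nat) :
  \sum_(la <- A m n) omega1 la = \sum_(mu <- B m n) omega2 mu.
Proof.
have -> : \sum_(la <- A m n) omega1 la =
    \sum_(s <- listA m n.+1 | sumn s == n) omega1 s.
  rewrite -[RHS]big_filter; apply/perm_big/uniq_perm => [||s].
  - exact: fset_uniq.
  - by rewrite filter_uniq ?listA_uniq.
  - by rewrite mem_filter andbC mem_listA // -mem_A.
have -> : \sum_(mu <- B m n) omega2 mu =
    \sum_(t <- revlistB m n.+1 0 | sumn t == n) omega2 t.
  rewrite -[RHS]big_filter.
  rewrite (perm_big (map rev [seq t <- revlistB m n.+1 0 | sumn t == n])).
    by rewrite big_map; apply: eq_bigr => t _; rewrite /omega2 size_rev.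
  apply: uniq_perm => [||s].
  - exact: fset_uniq.
  - by rewrite (map_inj_uniq (can_inj revK)) filter_uniq ?revlistB_uniq.
  - rewrite -[s in RHS]revK (mem_map (can_inj revK)) mem_filter sumn_rev andbC.
    by rewrite mem_revlistB0 // mem_B.
(* [phi] is the projection modulo ['X^(n.+1)], which still determines the coefficient of degree
   [n]. *)
rewrite -!coef_gf; apply/in_qpoly_Xn_coef/gf_morph => //.
apply: val_inj => /=; rewrite mk_monic_Xn.
exact: Pdiv.RingMonic.rmodpp (monicXn _ _).
Qed.
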